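(* Let $L=(L,\wedge,\vee,1,0)$ be a complete lattice and $X\subseteq L\setminus\{1\}$ a subset such that $L$ is an $X$-top lattice, and equip $X$ with its Zariski-like topology. (1) $X$ is $T_0$. (2) If $X$ is finite, then $X$ is spectral. (3) $\mathrm{Max}(X)=\mathrm{Max}(C^X(L)\setminus\{1\})$. (4) The following are equivalent: $X$ is $T_1$; $X$ is $R_0$; $K.\dim(X)=0$. (5) The following are equivalent: $X$ is $T_2$; $X$ is $R_1$; $K.\dim(X)=0$ and $X$ is quasi-Hausdorff.
   Context: For a complete lattice $L=(L,\wedge,\vee,1,0)$, $X\subseteq L\setminus\{1\}$ and $a\in L$, put $V(a)=\{x\in X: a\le x\}$ and $D(a)=X\setminus V(a)$. $L$ is an $X$-top lattice iff the family $\{V(a):a\in L\}$ is closed under finite unions (it always contains $X=V(0)$, $\emptyset=V(1)$ and is closed under arbitrary intersections); then the sets $D(a)$, $a\in L$, are the open sets of a topology on $X$, called the Zariski-like topology. $X$ is a poset with the order of $L$. For a poset $P$, $\mathrm{Max}(P)$ is the set of maximal elements of $P$. The empty meet is $1$. $C^X(L)=\{a\in L: a=\bigwedge_{y\in V(a)}y\}$ is the set of $X$-radical elements. The height of $x\in X$ is $ht(x)=\sup\{n\ge 0: \text{there are } x_0<x_1<\dots<x_n=x \text{ in } X\}$, and $K.\dim(X)=\sup\{ht(x):x\in X\}$ (suprema in $\{0,1,2,\dots,\infty\}$). Two points are topologically distinguishable iff some open set contains exactly one of them. A space is $R_0$ iff any two topologically distinguishable points $x,y$ are separated (there are open $U_x\ni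 x$, $U_y\ni y$ with $y\notin U_x$, $x\notin U_y$); it is $R_1$ iff any two topologically distinguishable points have disjoint open neighborhoods. A space is spectral iff it is sober (every irreducible closed subset is the closure of a unique point), compact (every open cover has a finite subcover; no Hausdorff condition) and has a base of compact open sets closed under finite intersections. A space is quasi-Hausdorff iff for any $x\ne y$, either $x,y$ have disjoint open neighborhoods or there is a point $z$ with $\{x,y\}\subseteq\overline{\{z\}}$. *)

(* Defs.v *)
From HB Require Import structures.
From mathcomp Require Import all_boot all_order all_algebra.
From mathcomp Require Import all_classical all_reals all_analysis.

Set Implicit Arguments.
Unset Strict Implicit.
Unset Printing Implicit Defensive.

Import Order.TTheory.

Local Open Scope classical_set_scope.
Local Open Scope order_scope.

Definition complete_lattice (d : Order.disp_t) (L : tbLatticeType d) : Prop :=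
  forall A : set L, infimums A !=set0 /\ supremums A !=set0.

Section XTop.
Context (d : Order.disp_t) (L : tbLatticeType d).
Implicit Types (X P : set L) (a x : L).

Definition V X a : set L := [set x | X x /\ a <= x].

Definition D X a : set L := X `\` V X a.

(* Binary unions suffice: the empty union is V X \top when \top is not in X. *)
Definition X_top_lattice X : Prop := setU_closed (range (V X)).

Definition Max P : set L := [set x | P x /\ forall y, P y -> x <= y -> y = x].

(* [infimum \top A] is \top for empty A, the empty meet, and otherwise the
   greatest lower bound of A, which exists when L is complete. *)
Definition radical X : set L := [set a | a = infimum \top (V X a)].

Definition chain_to X x (n : nat) : Prop :=
  exists c : nat -> L,
    [/\ forall i, (i <= n)%N -> X (c i),
        forall i, (i < n)%N -> c i < c i.+1 &
        c n = x].

(* Suprema in {0, 1, 2, ..., oo} are computed in [\bar int]; in particular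
   the supremum of the empty set is 0, so that Kdim set0 = 0. *)
Definition sup_enat (A : set (\bar int)) : \bar int := supremum 0%E A.

Definition ht X x : \bar int := sup_enat [set n%:Z%:E%E | n in chain_to X x].

Definition Kdim X : \bar int := sup_enat [set ht X x | x in X].

End XTop.

Section ZariskiTopology.
Context (d : Order.disp_t) (L : tbLatticeType d) (X : set L).
Hypotheses (cL : complete_lattice L) (X1 : X `<=` [set~ \top])
  (topX : X_top_lattice X).

(* The subtype X, indexed by the proofs that its D-sets form a topology. *)
Definition zariski of complete_lattice L & X `<=` [set~ \top]
  & X_top_lattice X : Type := set_type X.

Local Notation Z := (zariski cL X1 topX).

HB.instance Definition _ := Choice.copy Z (set_type X).

Definition zariski_open : set (set Z) :=
  [set U | exists a : L, U = [set x : Z | D X a (val x)]].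

Let in_X (x : Z) : X (val x). Proof. exact: set_valP. Qed.

Let zariski_openT : zariski_open setT.
Proof.
exists \top; apply/seteqP; split=> // x _; split; first exact: in_X.
by move=> [/X1 xN1]; rewrite le1x => /eqP.
Qed.

Let zariski_openI : setI_closed zariski_open.
Proof.
move=> _ _ [a ->] [b ->].
have [||c _ Vc] := topX (A := V X a) (B := V X b); [by exists a | by exists b |].
by exists c; rewrite /D Vc; apply/seteqP; split=> x /=; rewrite not_orP;
   [case=> -[Xx ?] [_ ?] | case=> Xx [? ?]]; split.
Qed.

Let zariski_open_bigU (I : Type) (f : I -> set Z) :
  (forall i, zariski_open (f i)) -> zariski_open (\bigcup_i f i).
Proof.
move=> /choice[a fE]; have [_ [s [ub_s lub_s]]] := cL (range a).
exists s; apply/seteqP; split=> x /=.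
  case=> i _; rewrite fE => -[Xx aNx]; split=> // -[_ sx]; apply: aNx.
  by split=> //; apply: le_trans sx; apply: ub_s; exists i.
move=> [Xx sNx]; apply: contrapT => nU; apply: sNx; split=> //.
apply: lub_s => _ [i _ <-]; apply: contrapT => aNx; apply: nU.
by exists i => //; rewrite fE; split=> // -[_].
Qed.

HB.instance Definition _ := isOpenTopological.Build Z
  zariski_openT zariski_openI zariski_open_bigU.

End ZariskiTopology.

Section Spaces.
Variable T : topologicalType.

Definition top_distinguishable (x y : T) : Prop :=
  exists U : set T, open U /\ (U x /\ ~ U y \/ U y /\ ~ U x).

Definition separated_pts (x y : T) : Prop :=
  exists U W : set T, [/\ open U, open W, U x /\ ~ U y & W y /\ ~ W x].

Definition disjoint_nbhds (x y : T) : Prop :=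
  exists U W : set T, [/\ open U, open W, U x, W y & U `&` W = set0].

Definition R0_space : Prop :=
  forall x y : T, top_distinguishable x y -> separated_pts x y.

Definition R1_space : Prop :=
  forall x y : T, top_distinguishable x y -> disjoint_nbhds x y.

Definition irreducible_set (A : set T) : Prop :=
  A !=set0 /\ forall F G : set T, closed F -> closed G ->
    A `<=` F `|` G -> A `<=` F \/ A `<=` G.

Definition sober_space : Prop :=
  forall A : set T, closed A -> irreducible_set A ->
    exists! x : T, A = closure [set x].

Definition spectral_space : Prop :=
  [/\ sober_space,
      cover_compact [set: T] &
      exists B : set (set T),
        [/\ basis B, B `<=` @cover_compact T & setI_closed B]].

Definition quasi_hausdorff : Prop :=
  forall x y : T, x <> y -> disjoint_nbhds x y \/
    exists z : T, [set x; y] `<=` closure [set z].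

End Spaces.

(* Main.v *)
Require Import Defs.
From mathcomp Require Import all_boot all_order all_algebra finmap.
From mathcomp Require Import all_classical all_reals all_analysis.

(** The closure of a point [z] of [X] is [V z], so open sets are down-closed and
    the specialization order is the order of the lattice. Being a partial order,
    it makes [X] a T0 space, hence distinct points are distinguishable and R0
    (resp. R1) is the same as T1 (resp. T2). [X] is T1 exactly when its order is
    trivial, which is what dimension 0 means; the points lying over a common
    point [z] then coincide, so quasi-Hausdorff reduces to Hausdorff. In a finite
    space an irreducible closed set is the finite union of the closures of its
    points, hence the closure of one of them. *)

Import Order.TTheory.

Set Implicit Arguments.
Unset Strict Implicit.
Unset Printing Implicit Defensive.

Local Open Scope classical_set_scope.

(** * Finite topological spaces: compactness, irreducible sets, spectrality *)

Section FiniteSpaces.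
Variable T : topologicalType.
Implicit Type A : set T.

Lemma finite_cover_compact A : finite_set A -> cover_compact A.
Proof.
case/finite_seqP=> s -> {A} I D f _; elim: s => [_|x s IHs sDf].
  by exists fset0 => // y; rewrite /= in_nil.
have [i Di fix_] := sDf x (mem_head x s).
have [y ys|E ED sE] := IHs; first by apply: sDf; rewrite /= in_cons ys orbT.
exists (i |` E)%fset => [j|y /=].
  by rewrite in_fset1U => /predU1P[->|/ED//]; rewrite inE.
rewrite in_cons => /predU1P[->|/sE[j jE fjy]].
  by exists i => //=; rewrite fset1U1.
by exists j => //=; rewrite fset1Ur.
Qed.

(** Irreducibility splits off one closed set of the finite union at a time; nonemptiness of [A]
    rules out the empty list. *)
Lemma irreducible_bigcup A (I : choiceType) (s : seq I) (F : I -> set T) :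
    irreducible_set A -> (forall i, closed (F i)) ->
    A `<=` \bigcup_(i in [set` s]) F i ->
  exists2 i, i \in s & A `<=` F i.
Proof.
move=> [[a Aa] irrA] clF; elim: s => [/(_ a Aa)[]//|i s IHs].
rewrite !bigcup_seq big_cons in IHs * => /irrA[||AFi|/IHs[j js AFj]] //.
- exact: closed_bigsetU.
- by exists i; rewrite ?mem_head.
- by exists j; rewrite // in_cons js orbT.
Qed.

Lemma finite_irreducible_closure A :
  finite_set A -> closed A -> irreducible_set A ->
  exists x : T, A = closure [set x].
Proof.
case/finite_seqP=> s As clA irrA.
have [||x xs Ax] := irreducible_bigcup (s := s) (F := fun x => closure [set x]) irrA.
- by move=> x; exact: closed_closure.
- by rewrite As => x xs; exists x => //; exact: subset_closure.
(* Conversely, [A] is a closed set containing [x], so it contains the closure of [x]. *)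
exists x; apply/seteqP; split=> //; rewrite closureE; apply: smallest_sub => //.
by rewrite As => _ ->.
Qed.

(** The closure hypothesis is T0 in disguise and makes generic points unique. Every subset is
    compact, so the family of all open sets serves as the base. *)
Lemma finite_spectral :
    finite_set [set: T] -> (forall x y : T, closure [set x] = closure [set y] -> x = y) ->
  spectral_space T.
Proof.
move=> finT inj_cl; have fin A : finite_set A by apply: sub_finite_set finT.
split.
- move=> A clA irrA; have [x Ax] := finite_irreducible_closure (fin A) clA irrA.
  by exists x; split=> // y; rewrite Ax; exact: inj_cl.
- exact: finite_cover_compact.
- exists open; split; last exact: openI.
    by split=> // x U; rewrite nbhsE => -[V [oV Vx] VU]; exists V.
  by move=> U _; exact: finite_cover_compact.
Qed.

End FiniteSpaces.

(** * Separation axioms and topological distinguishability *)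

Section Separation.
Variable T : topologicalType.

Lemma kolmogorov_distinguishable (x y : T) :
  kolmogorov_space T -> x <> y -> top_distinguishable x y.
Proof.
move=> T0 /eqP/T0[A [|]]; rewrite !inE nbhsE => -[[U [oU Ux] UA] nA].
  by exists U; split=> //; left; split=> // /UA.
by exists U; split=> //; right; split=> // /UA.
Qed.

Lemma top_distinguishable_neq (x y : T) : top_distinguishable x y -> x <> y.
Proof. by move=> [U [_ [[Ux Uy]|[Uy Ux]]]] xy; move: Ux Uy; rewrite xy. Qed.

Lemma accessible_R0 : accessible_space T -> R0_space T.
Proof.
move=> T1 x y /top_distinguishable_neq/eqP xy.
have [U [oU]] := T1 x y xy; rewrite !inE => Ux Uy.
rewrite eq_sym in xy; have [W [oW]] := T1 y x xy; rewrite !inE => Wy Wx.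
by exists U, W.
Qed.

Lemma disjoint_separated (x y : T) : disjoint_nbhds x y -> separated_pts x y.
Proof.
move=> [U [W [oU oW Ux Wy UW0]]]; exists U, W.
have UWF z : U z -> W z -> False by move=> Uz Wz; rewrite -[False]/(set0 z) -UW0.
by split=> //; split=> // /UWF; apply.
Qed.

Lemma R1_R0 : R1_space T -> R0_space T.
Proof. by move=> R1 x y /R1/disjoint_separated. Qed.

Lemma hausdorffP :
  hausdorff_space T <-> forall x y : T, x <> y -> disjoint_nbhds x y.
Proof.
rewrite open_hausdorff; split=> [T2 x y /eqP/T2[[U W]] /=|T2 x y /eqP/T2].
  by rewrite !inE => -[Ux Wy] [oU oW UW0]; exists U, W; split.
by move=> [U [W [oU oW Ux Wy UW0]]]; exists (U, W); rewrite ?inE.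
Qed.

Lemma hausdorff_R1 : hausdorff_space T -> R1_space T.
Proof. by move=> /hausdorffP T2 x y /top_distinguishable_neq/T2. Qed.

End Separation.

(** * Suprema of sets of extended natural numbers *)

Section Suprema.
Local Open Scope ereal_scope.
Implicit Type A : set (\bar int).

Definition enat : set (\bar int) := [set e | 0 <= e].

Lemma enatP e : enat e -> e = +oo \/ exists n : nat, e = n%:Z%:E.
Proof.
rewrite /enat /=; case: e => [[n|n]| |] //; last by left.
by move=> _; right; exists n.
Qed.

(** [supremum] chooses an element of [supremums A], so that set must be shown inhabited: by the
    least natural upper bound if one exists, and by [+oo] otherwise. *)
Lemma sup_enatP A : A `<=` enat -> A !=set0 -> supremums A (sup_enat A).
Proof.
move=> An0 A0; rewrite /sup_enat /supremum ifF; last exact/negbTE/set0P.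
apply: xgetPex; have [e0 Ae0] := A0.
(* An upper bound dominates a nonnegative element, hence is a natural number or [+oo]. *)
have ub_enat u : ubound A u -> enat u by move=> /(_ _ Ae0); apply/le_trans/An0.
pose bnd n := `[< ubound A n%:Z%:E >].
have [exb|nexb] := pselect (exists n, bnd n).
  exists (ex_minn exb)%:Z%:E; case: ex_minnP => m /asboolP ubm min_m.
  split=> // u ubu; have [->|[k uk]] := enatP (ub_enat u ubu); first exact: leey.
  by rewrite uk lee_fin lez_nat; apply: min_m; apply/asboolP; rewrite -uk.
exists +oo; split=> [e _|u ubu]; first exact: leey.
have [->//|[k uk]] := enatP (ub_enat u ubu).
by case: nexb; exists k; apply/asboolP; rewrite -uk.
Qed.

Lemma sup_enat_ge0 A : A `<=` enat -> enat (sup_enat A).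
Proof.
move=> An0; have [->|/set0P A0] := eqVneq A set0.
  by rewrite /sup_enat supremum0 /enat /=.
have [ubA _] := sup_enatP An0 A0; have [e Ae] := A0.
by apply: le_trans (ubA _ Ae); apply: An0.
Qed.

Lemma sup_enat_eq0 A : A `<=` enat -> (sup_enat A = 0 <-> A `<=` [set 0]).
Proof.
move=> An0; split=> [A0 e Ae|A0].
  have [ubA _] := sup_enatP An0 (ex_intro _ e Ae).
  by apply/eqP; rewrite eq_le (An0 e Ae : is_true (0 <= e)) andbT -A0; exact: ubA.
(* Either [A] is empty, and the default value 0 is returned, or it is the singleton of 0. *)
by have [->|->] := subset_set1 A0; rewrite /sup_enat ?supremum0 ?supremum1.
Qed.

End Suprema.

(** * Heights, dimension and radical elements in the lattice *)

Section XTop.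
Context (d : Order.disp_t) (L : tbLatticeType d).
Implicit Types (X : set L) (a x y : L).
Local Open Scope order_scope.

Lemma ht_ge0 X x : enat (ht X x).
Proof. by apply: sup_enat_ge0 => _ [n _ <-]; rewrite /enat /= lee_fin. Qed.

Lemma ht_eq0 X x : X x -> (ht X x = 0%E <-> forall y, X y -> y <= x -> y = x).
Proof.
move=> Xx; rewrite /ht sup_enat_eq0 => [|_ [n _ <-]]; last by rewrite /enat /= lee_fin.
split=> [ht0 y Xy yx|minx _ [[|n] [c [cX clt cx]] <-] //].
  apply: contrapT => /eqP yNx.
  (* A point [y] strictly below [x] gives a chain of length 1 ending at [x]. *)
  have /ht0[]// : [set n%:Z%:E%E | n in chain_to X x] 1%E.
    exists 1%N => //; exists (fun i => if i is 0%N then y else x).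
    by split=> // -[|i] // _; rewrite lt_neqAle yNx.
(* In a chain of length [n.+1], the last but one term [c n] lies strictly below [x], against
   minimality. *)
have := clt n (leqnn _); have := cX n (leqnSn _); rewrite cx => Xcn cnx.
by move: (cnx); rewrite (minx _ Xcn (ltW cnx)) ltxx.
Qed.

Lemma Kdim_eq0 X :
  Kdim X = 0%E <-> forall x y, X x -> X y -> x <= y -> x = y.
Proof.
rewrite /Kdim sup_enat_eq0 => [|_ [x _ <-]]; last exact: ht_ge0.
split=> [ht0 x y Xx Xy|anti _ [x Xx <-]].
  by have /(ht_eq0 Xy) : ht X y = 0%E; [apply: ht0; exists y|apply].
by apply/ht_eq0 => // y Xy; exact: anti.
Qed.

(** Were [V X a] empty, [a] would be the empty meet, which is [\top]. *)
Lemma radical_ub X a : complete_lattice L -> a <> \top -> radical X a ->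
  exists2 y, X y & a <= y.
Proof.
move=> cL aN1 ra; apply: contrapT => nV; apply: aN1.
rewrite ra /infimum ifT //; apply/eqP/seteqP; split=> // y [Xy ay].
by apply: nV; exists y.
Qed.

(** A point [x] of [X] is the least element of [V X x], hence its meet. *)
Lemma sub_radical X : X `<=` radical X.
Proof.
move=> x Xx; have Vx : V X x x by [].
have infx : infimums (V X x) x.
  by split=> [y []//|y lby]; exact: lby.
rewrite /radical /= /infimum ifF; last by apply/negbTE/set0P; exists x.
have [lb1 glb1] := xgetPex \top (ex_intro _ x infx).
have [lbx glbx] := infx.
by apply/eqP; rewrite eq_le lb1 // andbT; exact: glb1.
Qed.

(** [X] is a cofinal subset of the proper radical elements, and a cofinal subset of a poset has the
    same maximal elements. *)
Lemma Max_radical X : complete_lattice L -> X `<=` [set~ \top] ->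
  Max X = Max (radical X `\ \top).
Proof.
move=> cL X1; apply/seteqP; split=> x [].
  move=> Xx maxx; split; first by split; [exact: sub_radical|exact: X1].
  move=> a [ra aN1] xa; have [y Xy ay] := radical_ub cL aN1 ra.
  have yx := maxx y Xy (le_trans xa ay).
  by apply: le_anti; rewrite xa -{1}yx ay.
move=> [rx xN1] maxx; have sub y : X y -> x <= y -> y = x.
  by move=> Xy; apply: maxx; split; [exact: sub_radical|exact: X1].
by have [y Xy xy] := radical_ub cL xN1 rx; split=> //; rewrite -(sub y Xy xy).
Qed.

End XTop.

(** * The Zariski-like topology and its separation properties *)

Section Zariski.
Context (d : Order.disp_t) (L : tbLatticeType d) (X : set L).
Hypotheses (cL : complete_lattice L) (X1 : X `<=` [set~ \top%O])
  (topX : X_top_lattice X).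
Local Notation Z := (zariski cL X1 topX).
Implicit Types (x y z : Z) (U : set Z).
Local Open Scope order_scope.

Lemma zariski_openP U : open U <-> exists a, U = [set x : Z | ~ a <= val x].
Proof.
have DE a : [set x : Z | D X a (val x)] = [set x : Z | ~ a <= val x].
  apply/seteqP; split=> x /=.
    by move=> [_ nVa] ax; apply: nVa; split=> //; exact: set_valP.
  by move=> nax; split; [exact: set_valP|case].
by split=> -[a ->]; exists a; rewrite DE.
Qed.

Lemma open_zariskiD a : open [set x : Z | ~ a <= val x].
Proof. by apply/zariski_openP; exists a. Qed.

Lemma zariski_open_le U x y : open U -> val x <= val y -> U y -> U x.
Proof. by move=> /zariski_openP[a ->] xy nay ax; apply: nay; exact: le_trans xy. Qed.

Lemma closure_zariski1 z : closure [set z] = [set x : Z | val z <= val x].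
Proof.
apply/seteqP; split=> x /= => [zcl|zx B].
  apply: contrapT => nzx.
  (* Otherwise the complement of [V X (val z)] is a neighborhood of [x] that misses [z]. *)
  have /zcl[y [/= ->]] : nbhs x [set x : Z | ~ val z <= val x].
    by apply: open_nbhs_nbhs; split=> //; exact: open_zariskiD.
  by apply.
rewrite nbhsE => -[U [oU Ux] UB]; exists z; split=> //; apply: UB.
exact: zariski_open_le Ux.
Qed.

Lemma closure_zariski_inj x y : closure [set x] = closure [set y] -> x = y.
Proof.
rewrite !closure_zariski1 => /seteqP[xy yx]; apply/val_inj/le_anti.
by rewrite (xy x (lexx _)) (yx y (lexx _)).
Qed.

Lemma zariski_kolmogorov : kolmogorov_space Z.
Proof.
(* The complement of the up-set of a point misses that point. Excluding the larger point [x] leaves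
   [y] inside; if [y] is not below [x], excluding [y] leaves [x] inside. *)
move=> x y xy; have [yx|/negP nyx] := boolP (val y <= val x).
  exists [set z : Z | ~ val x <= val z]; right; rewrite !inE; split.
    apply: open_nbhs_nbhs; split; first exact: open_zariskiD.
    by move=> /= xley; case/eqP: xy; apply/val_inj/le_anti; rewrite xley.
  by apply; exact: lexx.
exists [set z : Z | ~ val y <= val z]; left; rewrite !inE; split.
  by apply: open_nbhs_nbhs; split=> //; exact: open_zariskiD.
by apply; exact: lexx.
Qed.

Lemma zariski_spectral : finite_set X -> spectral_space Z.
Proof.
move=> finX; apply: finite_spectral; last exact: closure_zariski_inj.
have fin_val : finite_set ((fun x : Z => val x) @^-1` X).
  by apply: finite_preimage => // x y _ _; exact: val_inj.
by apply: sub_finite_set fin_val => x _; exact: set_valP.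
Qed.

Lemma Kdim0P : Kdim X = 0%E <-> forall x y, val x <= val y -> x = y.
Proof.
rewrite Kdim_eq0; split=> [anti x y xy|anti x y Xx Xy xy].
  by apply/val_inj/anti => //; exact: set_valP.
by have /(congr1 val) := anti (SigSub (mem_set Xx)) (SigSub (mem_set Xy)) xy.
Qed.

Lemma R0_Kdim0 : R0_space Z -> Kdim X = 0%E.
Proof.
move=> R0; apply/Kdim0P => x y xy; apply: contrapT => xNy.
have [U [W [oU oW _ [Wy Wx]]]] := R0 x y (kolmogorov_distinguishable zariski_kolmogorov xNy).
(* An open set around the larger point [y] contains the smaller point [x], so the two cannot be
   separated. *)
by apply: Wx; exact: zariski_open_le Wy.
Qed.

Lemma Kdim0_accessible : Kdim X = 0%E -> accessible_space Z.
Proof.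
move=> /Kdim0P anti x y xy; exists [set z : Z | ~ val y <= val z].
rewrite !inE; split; first exact: open_zariskiD.
  by move=> /= /anti yx; rewrite yx eqxx in xy.
by apply; exact: lexx.
Qed.

Lemma zariski_R1_quasi_hausdorff : R1_space Z -> quasi_hausdorff Z.
Proof.
by move=> R1 x y /(kolmogorov_distinguishable zariski_kolmogorov)/R1; left.
Qed.

Lemma Kdim0_quasi_hausdorff : Kdim X = 0%E -> quasi_hausdorff Z -> hausdorff_space Z.
Proof.
move=> /Kdim0P anti qH; apply/hausdorffP => x y xy; have [//|[z]] := qH x y xy.
rewrite closure_zariski1 => zxy; case: xy.
(* The common point [z] lies below both [x] and [y], and the trivial order identifies all three. *)
have <- : z = x by apply/anti/zxy; left.
by apply/anti/zxy; right.
Qed.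

End Zariski.

Theorem proposition2p9 (d : Order.disp_t) (L : tbLatticeType d)
    (cL : complete_lattice L) (X : set L) (X1 : X `<=` [set~ \top%O])
    (topX : X_top_lattice X) :
  let Z : topologicalType := zariski cL X1 topX in
  [/\ kolmogorov_space Z,
      finite_set X -> spectral_space Z,
      Max X = Max (radical X `\ \top%O),
      [<-> accessible_space Z; R0_space Z; Kdim X = 0%E] &
      [<-> hausdorff_space Z; R1_space Z;
           Kdim X = 0%E /\ quasi_hausdorff Z]].
Proof.
move=> Z; split.
- exact: zariski_kolmogorov.
- exact: zariski_spectral.
- exact: Max_radical.
- tfae; [exact: accessible_R0 | exact: R0_Kdim0 | exact: Kdim0_accessible].
- tfae; first exact: hausdorff_R1.
    move=> R1; split; last exact: zariski_R1_quasi_hausdorff.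
    by apply: R0_Kdim0; exact: R1_R0.
  by case; exact: Kdim0_quasi_hausdorff.
Qed.
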